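(* For $n\geq 2$, let $\mathcal{CG}(S_n)$ be the set of isomorphism classes of groups that occur as critical groups of arithmetical structures on the star graph $S_n$. Then $\lvert\mathcal{CG}(S_n)\rvert\geq 2^{n-2}$.
   Context: An arithmetical structure on a finite, connected, loopless graph $G$ with vertex set $V(G)$ is a pair $(\mathbf{d},\mathbf{r})$, where $\mathbf{r}=(r_v)_{v\in V(G)}$ consists of positive integers with no common factor, $\mathbf{d}=(d_v)_{v\in V(G)}$ consists of nonnegative integers, and for every vertex $v$ we have $r_vd_v=\sum r_u$, the sum being over all $u$ adjacent to $v$ (with multiplicity for multigraphs). Its critical group is the torsion part of the cokernel (over $\mathbb{Z}$) of the matrix $\operatorname{diag}(\mathbf{d})-A(G)$, where $A(G)$ is the adjacency matrix of $G$. The star graph $S_n$ has $n$ leaves, each joined by one edge to a central vertex (and no other edges). *)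

(* Defs.v *)
From HB Require Import structures.
From mathcomp Require Import all_boot all_order all_algebra.
From mathcomp Require Import boolp.

Set Implicit Arguments.
Unset Strict Implicit.
Unset Printing Implicit Defensive.

Import GRing.Theory.
Local Open Scope ring_scope.

(* Vertices are numbered; edges u v is the multiplicity of the edge uv, so that
   edges is the adjacency matrix. *)
Record multigraph := Multigraph {
  nverts : nat;
  edges : 'M[nat]_nverts;
  nverts_gt0 : (0 < nverts)%N;
  edges_sym : forall u v, edges u v = edges v u;
  edges_loopless : forall v, edges v v = 0%N;
  edges_connected : forall u v, connect (fun x y => 0 < edges x y)%N u v
}.

Record arith_structure (G : multigraph) := ArithStructure {
  d_of : 'I_(nverts G) -> nat;
  r_of : 'I_(nverts G) -> nat;
  r_of_gt0 : forall v, (0 < r_of v)%N;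
  r_of_gcd : \big[gcdn/0%N]_v r_of v = 1%N;
  d_ofE : forall v, (r_of v * d_of v = \sum_u edges G v u * r_of u)%N
}.

Definition arith_mx (G : multigraph) (S : arith_structure G) :
    'M[int]_(nverts G) :=
  diag_mx (\row_v (d_of S v)%:Z) - map_mx Posz (edges G).

Section Cokernel.
Variables (m : nat) (M : 'M[int]_m).

Definition col_lattice : {pred 'cV[int]_m} :=
  fun x => `[< exists y : 'cV[int]_m, x = M *m y >].

Lemma col_lattice_zmod_closed : zmod_closed col_lattice.
Proof.
split; first by apply/asboolP; exists 0; rewrite mulmx0.
move=> x y /asboolP[a ->] /asboolP[b ->].
by apply/asboolP; exists (a - b); rewrite mulmxBr.
Qed.

HB.instance Definition _ :=
  GRing.isZmodClosed.Build 'cV[int]_m col_lattice col_lattice_zmod_closed.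

Definition cokernel : zmodType := {ideal_quot col_lattice}.

End Cokernel.

Section Torsion.
Variable V : zmodType.

Definition torsion_pred : {pred V} :=
  fun x => `[< exists2 k : nat, (0 < k)%N & x *+ k = 0 >].

Lemma torsion_zmod_closed : zmod_closed torsion_pred.
Proof.
split; first by apply/asboolP; exists 1%N.
move=> x y /asboolP[k k0 xk] /asboolP[l l0 yl].
apply/asboolP; exists (k * l)%N; first by rewrite muln_gt0 k0.
by rewrite mulrnBl mulrnA xk mul0rn mulnC mulrnA yl mul0rn subr0.
Qed.

HB.instance Definition _ :=
  GRing.isZmodClosed.Build V torsion_pred torsion_zmod_closed.

Record torsion_part := TorsionPart {
  torsion_val :> V;
  torsion_valP : torsion_val \in torsion_pred
}.

HB.instance Definition _ := [isSub for torsion_val].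
HB.instance Definition _ := [Choice of torsion_part by <:].
HB.instance Definition _ := [SubChoice_isSubZmodule of torsion_part by <:].

End Torsion.

Definition critical_group (G : multigraph) (S : arith_structure G) : zmodType :=
  torsion_part (cokernel (arith_mx S)).

Definition zmod_isomorphic (A B : zmodType) : Prop :=
  exists f : {additive A -> B}, bijective f.

(* Critical groups are abelian, so a group isomorphic to one is a zmodType. *)
Definition iso_class (A : zmodType) : zmodType -> Prop :=
  fun B => zmod_isomorphic A B.

(* Predicates are used here rather than the sets of the mathcomp.classical
   library, whose universe is too small to contain zmodType. *)
Definition critical_group_classes (G : multigraph) :
    (zmodType -> Prop) -> Prop :=
  fun C => exists S : arith_structure G, C = iso_class (critical_group S).

(* The collection P has at least N elements; P is not assumed to be finite. *)
Definition card_geq (T : Type) (P : T -> Prop) (N : nat) : Prop :=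
  exists2 f : 'I_N -> T, injective f & forall i, P (f i).

Section Star.
Variable n : nat.

(* The centre is ord0; the n other vertices are the leaves. *)
Definition star_edges : 'M[nat]_n.+1 :=
  \matrix_(u, v) ((u == ord0) (+) (v == ord0) : nat).

Lemma star_edges_sym u v : star_edges u v = star_edges v u.
Proof. by rewrite !mxE addbC. Qed.

Lemma star_edges_loopless v : star_edges v v = 0%N.
Proof. by rewrite mxE addbb. Qed.

Lemma star_edges_connected u v :
  connect (fun x y => 0 < star_edges x y)%N u v.
Proof.
have c0 w : connect (fun x y => 0 < star_edges x y)%N w ord0.
  have [->|w0] := eqVneq w ord0; first exact: connect0.
  by apply: connect1; rewrite mxE eqxx (negPf w0).
apply: connect_trans (c0 u) _.
have [->|v0] := eqVneq v ord0; first exact: connect0.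
by apply: connect1; rewrite mxE eqxx (negPf v0).
Qed.

Definition star : multigraph :=
  Multigraph (ltn0Sn n) star_edges_sym star_edges_loopless star_edges_connected.

End Star.

(* Main.v *)
Require Import Defs.
From HB Require Import structures.
From mathcomp Require Import all_boot all_order all_algebra.
From mathcomp Require Import boolp zify ring.

(* If the leaves carry x_1, ..., x_m, N, N with every x_i dividing N and with
   reciprocals adding up to an integer, then v lies in the column lattice iff it is
   orthogonal to r and x_i divides v_i - v_last for all i; hence the critical group
   is the direct sum of the Z/x_i.  It determines its exponent lcm(x_i) and its order
   prod(x_i).
   Take N = 2b with b = lcm(x_i) and 1/x_1 + ... + 1/x_m = k - 1/b.  This is
   preserved by adding a leaf b + 1 (the lcm becomes b(b + 1)) or a leaf 2b (the lcm
   becomes 2b); for b = 1 the second move is replaced by adding a leaf 1.  So each of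
   the 2^m words of m moves gives a structure, and a word can be read off the lcm and
   the product, last move first. *)

Set Implicit Arguments.
Unset Strict Implicit.
Unset Printing Implicit Defensive.

(** * Leaf sequences of words, their lcm and their reciprocal sum *)

Definition lcm_seq (s : seq nat) : nat := foldr lcmn 1 s.
Definition prod_seq (s : seq nat) : nat := \prod_(x <- s) x.

(** At [b = 1] the leaf [b.*2] would equal [b.+1] and the two moves would coincide; the leaf 1 keeps
    them apart. *)
Definition next_leaf (c : bool) (b : nat) : nat :=
  if c then b.+1 else if b == 1 then 1 else b.*2.

Fixpoint leaves (w : seq bool) : seq nat :=
  if w is c :: w' then next_leaf c (lcm_seq (leaves w')) :: leaves w' else [::].

Lemma size_leaves w : size (leaves w) = size w.
Proof. by elim: w => //= c w ->. Qed.

Lemma lcm_seq_dvd s k : (lcm_seq s %| k) = all (fun x => x %| k) s.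
Proof. by elim: s => [|x s IH] /=; rewrite ?dvd1n // dvdn_lcm IH. Qed.

Lemma lcm_next_leaf c b :
  lcmn (next_leaf c b) b = if c then b * b.+1 else next_leaf c b.
Proof.
case: c => /=.
  have /eqP co : coprime b b.+1 by rewrite coprimenS.
  by have := muln_lcm_gcd b b.+1; rewrite co muln1 lcmnC.
case: eqP => [->|_] //; rewrite lcmnC; apply/lcmn_idPr.
by rewrite -mul2n dvdn_mull.
Qed.

Lemma lcm_leaves_cons c w (b := lcm_seq (leaves w)) :
  lcm_seq (leaves (c :: w)) = if c then b * b.+1 else next_leaf c b.
Proof. exact: lcm_next_leaf. Qed.

Lemma lcm_leaves_gt0 w : 0 < lcm_seq (leaves w).
Proof.
elim: w => // c w IH; rewrite lcm_leaves_cons.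
case: c => /=; first by rewrite muln_gt0 IH.
by case: eqP => // _; rewrite double_gt0.
Qed.

Lemma lcm_leaves_even w :
  lcm_seq (leaves w) != 1 -> ~~ odd (lcm_seq (leaves w)).
Proof.
elim: w => // c w IH; rewrite lcm_leaves_cons.
case: c => /=; first by rewrite oddM /= andbN.
by rewrite /next_leaf; case: ifP => // _ _; rewrite odd_double.
Qed.

Lemma sum_quotient_scale s b q :
  (forall x, x \in s -> x %| b) ->
  \sum_(x <- s) (q * b) %/ x = q * \sum_(x <- s) b %/ x.
Proof.
by move=> sb; rewrite big_distrr /=; apply: eq_big_seq => x /sb xb; rewrite muln_divA.
Qed.

Lemma leaves_dvd_lcm w x : x \in leaves w -> x %| lcm_seq (leaves w).
Proof. by move: x; apply/allP; rewrite -lcm_seq_dvd. Qed.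

(** This is 1/x_1 + ... + 1/x_m = k - 1/b cleared of denominators. It is preserved because 1/(b+1) -
    1/b = -1/(b(b+1)) and 1/(2b) - 1/b = -1/(2b). *)
Lemma leaves_reciprocals w (b := lcm_seq (leaves w)) :
  b %| (\sum_(x <- leaves w) b %/ x).+1.
Proof.
rewrite {}/b; elim: w => [|c w]; first exact: dvd1n.
rewrite lcm_leaves_cons [leaves (c :: w)]/= big_cons.
have b0 := lcm_leaves_gt0 w; have sb := @leaves_dvd_lcm w.
move: (lcm_seq _) b0 sb => b b0 sb; case: c => /= IH.
  rewrite mulnK // [b * _]mulnC sum_quotient_scale //.
  by rewrite -addSn -mulnS dvdn_pmul2l.
case: eqP => _; first exact: dvd1n.
rewrite -mul2n divnn muln_gt0 b0 sum_quotient_scale //.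
by rewrite -addSn -mulnS dvdn_pmul2l.
Qed.

(** * Recovering a word from the lcm and the product *)

Lemma lcm_dvd_prod_leaves w : lcm_seq (leaves w) %| prod_seq (leaves w).
Proof.
rewrite lcm_seq_dvd; apply/allP => x xs.
by rewrite /prod_seq (big_rem x) //= dvdn_mulr.
Qed.

(** Ensures that a number prime to the lcm is prime to the product. *)
Lemma prod_leaves_dvd_lcm_exp w :
  prod_seq (leaves w) %| lcm_seq (leaves w) ^ size w.
Proof.
rewrite -size_leaves; have := @leaves_dvd_lcm w.
elim: (leaves w) (lcm_seq _) => [|x s IH] b sb; first by rewrite /prod_seq big_nil.
rewrite /prod_seq big_cons expnS dvdn_mul ?sb ?mem_head //.
by apply: IH => y ys; rewrite sb // in_cons ys orbT.
Qed.

(* If the last leaf is twice the lcm, then the square of the new lcm divides twice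
   the new product.  If it is [b.+1] with [b] even, this fails because [b.+1] is
   prime to [2] and to all earlier leaves. *)
Lemma lcm_prod_leaves_last w w' :
  lcm_seq (leaves (true :: w)) = lcm_seq (leaves (false :: w')) ->
  prod_seq (leaves (true :: w)) = prod_seq (leaves (false :: w')) -> False.
Proof.
rewrite !lcm_leaves_cons /= /prod_seq !big_cons -!/(prod_seq _).
have b0 := lcm_leaves_gt0 w; have c0 := lcm_leaves_gt0 w'.
have := lcm_leaves_even (w := w); have := lcm_dvd_prod_leaves w'.
have := prod_leaves_dvd_lcm_exp w.
move: (lcm_seq _) (prod_seq _) b0 => b P b0 Pb.
move: (lcm_seq _) (prod_seq _) c0 => c Q c0.
case: (c =P 1) => [_ _ _ /eqP|c1 /dvdnP[q ->] bev ebc eP].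
  by rewrite muln_eq1 => /andP[_] /=; rewrite eqSS; case: b b0 {Pb}.
(* [b = 1] would force [c = 1], the case just excluded. *)
have {bev} bev : ~~ odd b.
  by apply: bev; apply/eqP => b1; move: ebc; rewrite b1; lia.
(* Cancelling [b.+1] in the products gives [P = b * (q * c)], and [c.*2 = b * b.+1]. *)
have {ebc eP} bP : b.+1 %| 2 * P.
  have /eqP : b.+1 * P = b.+1 * (b * (q * c)).
    by rewrite eP -ebc; ring.
  rewrite eqn_pmul2l // => /eqP ->; apply/dvdnP; exists (b * q * b).
  have -> : 2 * (b * (q * c)) = b * q * c.*2 by rewrite -mul2n; ring.
  by rewrite -ebc; ring.
have co2 : coprime b.+1 2 by rewrite coprimen2 /= bev.
have coP : coprime b.+1 P.
  by apply: coprime_dvdr Pb _; rewrite coprimeXr // coprimeSn.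
have : coprime b.+1 (2 * P) by rewrite coprimeMr co2.
by rewrite /coprime (gcdn_idPl bP) eqSS; case: b b0 {Pb bev bP co2 coP}.
Qed.

Lemma next_leaf_double_inj : injective (next_leaf false).
Proof. by move=> b c; rewrite /next_leaf; do 2!case: eqP; lia. Qed.

(** Equal lengths are essential: words made of [false] alone all have lcm and product 1. *)
Lemma leaves_determined w w' :
  size w = size w' ->
  lcm_seq (leaves w) = lcm_seq (leaves w') ->
  prod_seq (leaves w) = prod_seq (leaves w') -> w = w'.
Proof.
elim: w w' => [|c w IH] [|c' w'] // [esz] eL eP.
have ec : c = c'.
  case: c c' eL eP => [] [] // eL eP; first by case: (lcm_prod_leaves_last eL eP).
  by case: (lcm_prod_leaves_last (esym eL) (esym eP)).
subst c'; congr cons; move: eL eP; rewrite !lcm_leaves_cons /prod_seq /= !big_cons.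
rewrite -!/(prod_seq _) => eL eP.
have eb : lcm_seq (leaves w) = lcm_seq (leaves w').
  by case: c eL {eP} => [|/next_leaf_double_inj //]; nia.
apply: IH => //; move/eqP: eP; rewrite eb eqn_pmul2l; first by move/eqP.
have := lcm_leaves_gt0 w'; rewrite /next_leaf; do 2!case: ifP => //; lia.
Qed.

(** * Stars with leaves x_1, ..., x_m, N, N *)

Section StarCriticalGroup.
Import GRing.Theory Num.Theory.
Local Open Scope ring_scope.

Lemma sum_star_edges_center n (V : nmodType) (f : 'I_n.+1 -> V) :
  \sum_u f u *+ star_edges n ord0 u = \sum_(j < n) f (lift ord0 j).
Proof.
rewrite big_ord_recl mxE addbb mulr0n add0r.
by apply: eq_bigr => j _; rewrite mxE eqxx.
Qed.

Lemma sum_star_edges_leaf n (V : nmodType) (f : 'I_n.+1 -> V) (j : 'I_n) :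
  \sum_u f u *+ star_edges n (lift ord0 j) u = f ord0.
Proof.
by rewrite (bigD1 ord0) //= mxE eqxx big1 ?addr0 // => u u0; rewrite mxE (negPf u0).
Qed.

Lemma arith_mx_mulE (G : multigraph) (S : arith_structure G) y v :
  (arith_mx S *m y) v (ord0 : 'I_1) =
  (d_of S v)%:Z * y v ord0 - \sum_u y u ord0 *+ edges G v u.
Proof.
rewrite mulmxBl mul_diag_mx !mxE; congr (_ - _).
by apply: eq_bigr => u _; rewrite mxE -mulr_natl natz.
Qed.

Lemma pi_eq_cokernel m (M : 'M[int]_m) (v w : 'cV[int]_m) :
  (\pi_(cokernel M)%qT v = \pi_(cokernel M)%qT w) <-> (v - w \in col_lattice M).
Proof. by rewrite Quotient.idealrBE; split => /eqP. Qed.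

Lemma colMnE m (v : 'cV[int]_m) k u : (v *+ k) u ord0 = v u ord0 *+ k.
Proof. by elim: k => [|k IH]; rewrite ?mxE // !mulrS mxE IH. Qed.

Lemma colBE m (v w : 'cV[int]_m) u : (v - w) u ord0 = v u ord0 - w u ord0.
Proof. by rewrite !mxE. Qed.

Lemma torsion_valMn (V : zmodType) (z : torsion_part V) k :
  torsion_val (z *+ k) = torsion_val z *+ k.
Proof. exact: (raddfMn (val : torsion_part V -> V)). Qed.

Section LeafTail.
Variables (m : nat) (s : seq nat) (N d0 : nat).
Hypotheses (size_s : size s = m) (N_gt0 : (0 < N)%N).
Hypothesis s_dvd : forall x, x \in s -> (x %| N)%N.
(** The reciprocal sum, multiplied by [N]; the two leaves [N] contribute the 2. *)
Hypothesis recip : (N * d0 = \sum_(x <- s) N %/ x + 2)%N.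

(* Beyond [size s] the default value of [nth] supplies the two leaves equal to [N]. *)
Definition leaf (j : nat) : nat := nth N s j.

Definition star_d (v : 'I_m.+3) : nat := if v == ord0 then d0 else leaf v.-1.
Definition star_r (v : 'I_m.+3) : nat := if v == ord0 then N else (N %/ leaf v.-1)%N.

Lemma leaf_dvd j : (leaf j %| N)%N.
Proof.
rewrite /leaf; case: (ltnP j (size s)) => js; first by rewrite s_dvd ?mem_nth.
by rewrite nth_default.
Qed.

Lemma leaf_gt0 j : (0 < leaf j)%N.
Proof. by rewrite (dvdn_gt0 N_gt0) // leaf_dvd. Qed.

Lemma leaf_tail j : (m <= j)%N -> leaf j = N.
Proof. by move=> mj; rewrite /leaf nth_default // size_s. Qed.

Lemma sum_leaf_quotients : (\sum_(j < m.+2) N %/ leaf j = N * d0)%N.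
Proof.
rewrite !big_ord_recr /= !leaf_tail // divnn N_gt0 -addnA recip; congr addn.
by rewrite (big_nth N) big_mkord size_s.
Qed.

Lemma star_r_gt0 v : (0 < star_r v)%N.
Proof.
rewrite /star_r; case: ifP => // _.
by rewrite divn_gt0 ?leaf_gt0 // dvdn_leq ?leaf_dvd.
Qed.

(** The last leaf carries r = N/N = 1. *)
Lemma star_r_gcd : \big[gcdn/0%N]_v star_r v = 1%N.
Proof.
apply/eqP; rewrite -dvdn1; apply: (@biggcdn_inf _ ord_max) => //.
by rewrite /star_r /= leaf_tail // divnn N_gt0.
Qed.

Lemma star_dE v :
  (star_r v * star_d v = \sum_u edges (star m.+2) v u * star_r u)%N.
Proof.
transitivity (\sum_u star_r u *+ star_edges m.+2 v u); last first.
  by apply: eq_bigr => u _; rewrite -mulr_natl natn.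
case: (unliftP ord0 v) => [j|] ->.
  by rewrite sum_star_edges_leaf /star_r /star_d /= divnK ?leaf_dvd.
by rewrite sum_star_edges_center -sum_leaf_quotients.
Qed.

Definition star_structure : arith_structure (star m.+2) :=
  @ArithStructure (star m.+2) star_d star_r star_r_gt0 star_r_gcd star_dE.

(** * The column lattice and the torsion of the cokernel *)

Local Notation vec := 'cV[int]_m.+3.
Local Notation L := (col_lattice (arith_mx star_structure)).
Local Notation at_leaf v j := ((v : vec) (lift ord0 j) ord0).

(** The matrix is symmetric and kills r, so this pairing vanishes on the column lattice; its kernel
    yields the torsion. *)
Definition r_dot (v : vec) : int := \sum_u (star_r u)%:Z * v u ord0.

Lemma r_dotE v :
  r_dot v = N%:Z * v ord0 ord0 + \sum_(j < m.+2) (N %/ leaf j)%:Z * at_leaf v j.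
Proof. by rewrite /r_dot big_ord_recl. Qed.

(** The right-hand side pairs r with v plus c times the centre column, whose entries are d0 at the
    centre and -1 at the leaves. *)
Lemma r_dot_shift v c :
  r_dot v = N%:Z * (v ord0 ord0 + d0%:Z * c) +
            \sum_(j < m.+2) (N %/ leaf j)%:Z * (at_leaf v j - c).
Proof.
under eq_bigr do rewrite mulrBr.
rewrite r_dotE sumrB -mulr_suml (_ : \sum_(j < m.+2) (N %/ leaf j)%:Z = (N * d0)%N%:Z).
  by rewrite PoszM; ring.
by rewrite -sum_leaf_quotients (big_morph Posz PoszD (erefl 0%:Z)).
Qed.

Lemma quotient_mulK j : (N %/ leaf j)%:Z * (leaf j)%:Z = N%:Z.
Proof. by rewrite -PoszM divnK ?leaf_dvd. Qed.

Lemma leaf_row y j :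
  at_leaf (arith_mx star_structure *m y) j =
  (leaf j)%:Z * at_leaf y j - (y : vec) ord0 ord0.
Proof.
have := @arith_mx_mulE _ star_structure y (lift ord0 j).
by rewrite /= sum_star_edges_leaf.
Qed.

Lemma center_row y :
  (arith_mx star_structure *m y) ord0 ord0 =
  d0%:Z * (y : vec) ord0 ord0 - \sum_(j < m.+2) at_leaf y j.
Proof.
have := @arith_mx_mulE _ star_structure y ord0.
by rewrite /= sum_star_edges_center.
Qed.

Lemma col_latticeP v :
  reflect (r_dot v = 0 /\
           forall j : 'I_m.+2, ((leaf j)%:Z %| at_leaf v j - v ord_max ord0)%Z)
          (v \in L).
Proof.
have last_leaf : ord_max = lift ord0 ord_max :> 'I_m.+3 by apply: val_inj.
apply: (iffP (asboolP _)) => [[y ->]|[rv dv]].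
  split=> [|j]; last first.
    rewrite last_leaf !leaf_row (@leaf_tail m.+1) //.
    rewrite -[N%:Z](quotient_mulK j) opprB addrA addrNK -mulrA mulrCA -mulrBr.
    exact: dvdz_mulr.
  rewrite (r_dot_shift _ (- (y : vec) ord0 ord0)) center_row.
  rewrite [X in _ + X](eq_bigr (fun j => N%:Z * at_leaf y j)) => [|j _]; last first.
    by rewrite leaf_row opprK addrNK mulrA quotient_mulK.
  by rewrite -mulr_sumr; ring.
(* The last row with last entry 0 forces the centre entry [- v ord_max ord0]; the other leaf rows
   then force the quotients. *)
exists (\col_u if u == ord0 then - v ord_max ord0
               else ((v u ord0 - v ord_max ord0) %/ (leaf u.-1)%:Z)%Z).
apply/colP => u; case: (unliftP ord0 u) => [j|] ->.
  by rewrite leaf_row !mxE /= mulrC divzK ?dv //; ring.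
(* After multiplication by [N] the centre row becomes [r_dot v = 0]. *)
have NZ : N%:Z != 0 by rewrite eqz_nat -lt0n.
apply: (mulfI NZ); apply/eqP; rewrite -subr_eq0 -rv center_row.
rewrite (r_dot_shift _ (v ord_max ord0)) mxE /= mulrBr mulr_sumr.
rewrite [X in _ - (_ - X)](eq_bigr (fun j : 'I_m.+2 =>
    (N %/ leaf j)%:Z * (at_leaf v j - v ord_max ord0))) => [|j _]; last first.
  by rewrite mxE /= -(quotient_mulK j) -mulrA [_ * (_ %/ _)%Z]mulrC divzK ?dv.
by apply/eqP; ring.
Qed.

Local Notation coker := (cokernel (arith_mx star_structure)).
Local Notation pi := (\pi_coker%qT : vec -> coker).
Local Notation head j := (widen_ord (leqW (leqnSn m)) j).

(** At the first of the two leaves [N] divisibility is automatic: there r = 1, and once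
    [v ord_max ord0] is subtracted at the leaves all other terms of [r_dot v = 0] are multiples of
    [N]. *)
Lemma col_lattice_heads v :
  r_dot v = 0 ->
  (forall j : 'I_m, ((leaf j)%:Z %| at_leaf v (head j) - v ord_max ord0)%Z) ->
  v \in L.
Proof.
move=> rv dv; have last_leaf : ord_max = lift ord0 ord_max :> 'I_m.+3 by apply: val_inj.
apply/col_latticeP; split=> // j; case: (unliftP ord_max j) => [i|] ->; last first.
  by rewrite -last_leaf subrr dvdz0.
case: (unliftP ord_max i) => [{}i|] ->{j}.
  have -> : lift ord_max (lift ord_max i) = head i by apply: ord_inj; rewrite !lift_max.
  exact: dv.
rewrite lift_max leaf_tail //.
move: rv; rewrite (r_dot_shift _ (v ord_max ord0)) !big_ord_recr /=.
rewrite -last_leaf subrr mulr0 addr0 leaf_tail // divnn N_gt0 mul1r.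
have -> : widen_ord (leqnSn m.+1) ord_max = lift ord_max ord_max.
  by apply: ord_inj; rewrite lift_max.
rewrite addrA => /eqP; rewrite addrC addr_eq0 => /eqP ->.
rewrite rpredN rpredD // ?dvdz_mulr // rpred_sum // => k _.
rewrite -(quotient_mulK k) dvdz_mul //.
have -> : widen_ord (leqnSn m.+1) (widen_ord (leqnSn m) k) = head k by apply: val_inj.
exact: dv.
Qed.

Lemma r_dot_is_zmod_morphism : zmod_morphism r_dot.
Proof.
by move=> v w; rewrite /r_dot -sumrB; apply: eq_bigr => u _; rewrite !mxE mulrBr.
Qed.

HB.instance Definition _ :=
  GRing.isZmodMorphism.Build vec int r_dot r_dot_is_zmod_morphism.

Lemma r_dotMn v k : r_dot (v *+ k) = r_dot v *+ k.
Proof. exact: raddfMn. Qed.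

Lemma pi_eq0 v : pi v = 0 <-> v \in L.
Proof. by rewrite -(raddf0 pi) pi_eq_cokernel subr0. Qed.

(** Every leaf divides [N], so [N] kills the kernel of [r_dot] modulo the lattice. *)
Lemma torsion_pi v : (pi v \in torsion_pred (V := coker)) = (r_dot v == 0).
Proof.
apply/asboolP/eqP => [[k k0]|rv].
  rewrite -raddfMn => /pi_eq0/col_latticeP[] /eqP.
  by rewrite r_dotMn -mulr_natl mulf_eq0 pnatr_eq0 gtn_eqF // => /eqP.
exists N => //; rewrite -raddfMn; apply/pi_eq0/col_latticeP.
split=> [|j]; first by rewrite r_dotMn rv mul0rn.
by rewrite !colMnE -mulrnBl -mulr_natl natz dvdz_mulr // dvdzE /= leaf_dvd.
Qed.

(** Entries are free at the first m leaves and 0 at the centre and the last leaf; the remaining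
    leaf, where r = 1, makes [r_dot] vanish. *)
Definition heads_vec (a : 'I_m -> nat) : vec :=
  \col_u (if u == ord0 then 0 else
          if insub u.-1 is Some j then (a j)%:Z else
          if u.-1 == m then - (\sum_(j < m) (N %/ leaf j) * a j)%N%:Z else 0).

Lemma heads_vec_head a j : at_leaf (heads_vec a) (head j) = (a j)%:Z.
Proof.
rewrite mxE /=; case: insubP => [i _ /ord_inj -> //|].
by rewrite ltn_ord.
Qed.

Lemma heads_vec_last a : heads_vec a ord_max ord0 = 0.
Proof. by rewrite mxE /= insubF ?ltnNge ?leqnSn // gtn_eqF. Qed.

Lemma r_dot_heads_vec a : r_dot (heads_vec a) = 0.
Proof.
have last_leaf : ord_max = lift ord0 ord_max :> 'I_m.+3 by apply: val_inj.
rewrite r_dotE !big_ord_recr /= -last_leaf heads_vec_last mulr0 addr0.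
rewrite [heads_vec a ord0 _]mxE mulr0 add0r leaf_tail // divnn N_gt0 mul1r.
rewrite [heads_vec a (lift _ _) _]mxE /= insubF ?ltnn // eqxx.
rewrite (big_morph Posz PoszD (erefl 0%:Z)); apply/eqP; rewrite subr_eq0; apply/eqP.
apply: eq_bigr => j _; rewrite PoszM -heads_vec_head; congr (_ * heads_vec a _ _).
exact: val_inj.
Qed.

(** * Exponent and order of the critical group *)

Local Notation K := (critical_group star_structure).

Lemma r_dot_torsion (z : K) : r_dot (repr (torsion_val z)) = 0.
Proof. by apply/eqP; rewrite -torsion_pi reprK; apply: torsion_valP. Qed.

Definition torsion_pi_elt v (rv : r_dot v = 0) : K :=
  TorsionPart (etrans (torsion_pi v) (introT eqP rv)).

Lemma residue_subproof j (x : int) : (`|(x %% (leaf j)%:Z)%Z| < leaf j)%N.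
Proof.
have lj : (leaf j)%:Z != 0 by rewrite eqz_nat -lt0n leaf_gt0.
by rewrite -ltz_nat gez0_abs ?modz_ge0 // ltz_pmod // ltz_nat leaf_gt0.
Qed.

Definition residue j (x : int) : 'I_(leaf j) := Ordinal (residue_subproof j x).

Lemma residueP j x y :
  residue j x = residue j y <-> ((leaf j)%:Z %| x - y)%Z.
Proof.
have lj : (leaf j)%:Z != 0 by rewrite eqz_nat -lt0n leaf_gt0.
rewrite -eqz_mod_dvd; split=> [[]|/eqP e]; last by apply: val_inj; rewrite /= e.
by move/(congr1 Posz); rewrite !gez0_abs ?modz_ge0 // => ->.
Qed.

Lemma residue_nat j (a : 'I_(leaf j)) : residue j a%:Z = a.
Proof. by apply: val_inj; rewrite /= modz_nat /= modn_small. Qed.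

Lemma critical_group_annihilator k :
  (forall z : K, z *+ k = 0) <-> all (fun x => x %| k)%N s.
Proof.
split=> [Kk|/allP sk z].
  apply/(all_nthP N) => i; rewrite size_s => im; set j := Ordinal im.
  (* If k times the class of this indicator vector is 0, then [leaf j] divides k. *)
  pose a (i : 'I_m) : nat := i == j.
  have /(congr1 (@torsion_val _)) := Kk (torsion_pi_elt (r_dot_heads_vec a)).
  rewrite torsion_valMn /= -raddfMn => /pi_eq0/col_latticeP[_ /(_ (head j))].
  rewrite !colMnE heads_vec_last heads_vec_head mul0rn subr0 /a eqxx.
  by rewrite -mulr_natl natz mulr1 dvdzE.
apply: val_inj; rewrite /= torsion_valMn -[torsion_val z]reprK -raddfMn.
apply/pi_eq0/col_lattice_heads; first by rewrite r_dotMn r_dot_torsion mul0rn.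
move=> j; rewrite !colMnE -mulrnBl -mulr_natl natz dvdz_mulr // dvdzE /=.
by rewrite sk // mem_nth ?size_s.
Qed.

(** A bijection of sets suffices for the order. The residue map is injective by [col_lattice_heads],
    and [heads_vec] gives a section. *)
Lemma critical_group_residues :
  exists f : {dffun forall j : 'I_m, 'I_(leaf j)} -> K, bijective f.
Proof.
pose h (z : K) : {dffun forall j : 'I_m, 'I_(leaf j)} :=
  [ffun j : 'I_m => residue j (at_leaf (repr (torsion_val z)) (head j) -
                               repr (torsion_val z) ord_max ord0)].
pose f (a : {dffun forall j : 'I_m, 'I_(leaf j)}) : K :=
  torsion_pi_elt (r_dot_heads_vec (fun j => a j)).
have h_inj : injective h.
  move=> z z' /ffunP hz; apply: val_inj => /=.
  rewrite -[torsion_val z]reprK -[torsion_val z']reprK; apply/pi_eq_cokernel.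
  apply: col_lattice_heads; first by rewrite raddfB /= !r_dot_torsion subrr.
  move=> j; have := hz j; rewrite !ffunE => /residueP.
  by rewrite !mxE; congr (_ %| _)%Z; ring.
have hK : cancel f h.
  move=> a; apply/ffunP => j; rewrite ffunE -[RHS]residue_nat; apply/residueP.
  have : pi (repr (torsion_val (f a))) = pi (heads_vec (fun j => a j)) by rewrite reprK.
  move/pi_eq_cokernel/col_latticeP => [_ /(_ (head j))].
  by rewrite !colBE heads_vec_head heads_vec_last; congr (_ %| _)%Z; ring.
by exists f; exists h => // z; apply: h_inj; rewrite hK.
Qed.

Lemma critical_group_order :
  exists f : 'I_(\prod_(x <- s) x)%N -> K, bijective f.
Proof.
have card_F : #|{dffun forall j : 'I_m, 'I_(leaf j)}| = (\prod_(x <- s) x)%N.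
  rewrite card_dep_ffun foldrE big_map big_enum /= (big_nth N) big_mkord size_s.
  by apply: eq_bigr => j _; rewrite card_ord.
have [f f_bij] := critical_group_residues; rewrite -card_F.
by exists (f \o enum_val); apply: bij_comp f_bij _; apply: enum_val_bij.
Qed.

End LeafTail.

Lemma zmod_isomorphic_annihilator (A B : zmodType) k :
  zmod_isomorphic A B ->
  (forall x : A, x *+ k = 0) <-> (forall y : B, y *+ k = 0).
Proof.
case=> f [g fK gK]; split=> Hk x; first by rewrite -(gK x) -raddfMn Hk raddf0.
by apply: (can_inj fK); rewrite raddfMn Hk raddf0.
Qed.

Lemma iso_class_isomorphic (A B : zmodType) :
  iso_class A = iso_class B -> zmod_isomorphic A B.
Proof.
move=> e; rewrite -/(iso_class A B) e.
by exists (idfun : {additive B -> B}); exists id.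
Qed.

End StarCriticalGroup.

(** * Structures attached to words, and the count *)

Section WordStructure.
Variables (m : nat) (w : m.-tuple bool).
Let b := lcm_seq (leaves w).

Lemma size_word_leaves : size (leaves w) = m.
Proof. by rewrite size_leaves size_tuple. Qed.

Lemma double_lcm_leaves_gt0 : 0 < 2 * b.
Proof. by rewrite muln_gt0 lcm_leaves_gt0. Qed.

Lemma leaves_dvd_double_lcm x : x \in leaves w -> x %| 2 * b.
Proof. by move=> xw; rewrite dvdn_mull ?leaves_dvd_lcm. Qed.

(** The two leaves 2b add 1/b to k - 1/b, so the centre gets d = k, the quotient on the left. *)
Lemma double_lcm_reciprocals :
  2 * b * ((\sum_(x <- leaves w) b %/ x).+1 %/ b) =
  \sum_(x <- leaves w) (2 * b) %/ x + 2.
Proof.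
rewrite sum_quotient_scale; last exact: leaves_dvd_lcm.
by rewrite -mulnA [b * _]mulnC divnK ?leaves_reciprocals // mulnS addnC.
Qed.

Definition word_structure : arith_structure (star m.+2) :=
  star_structure size_word_leaves double_lcm_leaves_gt0 leaves_dvd_double_lcm
    double_lcm_reciprocals.

Lemma word_structure_annihilator k :
  (forall z : critical_group word_structure, (z *+ k = 0)%R) <-> b %| k.
Proof. by rewrite lcm_seq_dvd; apply: critical_group_annihilator. Qed.

End WordStructure.

Lemma word_structure_determined m (w w' : m.-tuple bool) :
  zmod_isomorphic (critical_group (word_structure w))
                  (critical_group (word_structure w')) ->
  w = w'.
Proof.
move=> iso; apply: val_inj; apply: leaves_determined; first by rewrite !size_tuple.
  have dvdE k : lcm_seq (leaves w) %| k <-> lcm_seq (leaves w') %| k.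
    rewrite -!word_structure_annihilator; exact: zmod_isomorphic_annihilator.
  by apply/eqP; rewrite eqn_dvd; apply/andP; split; apply/dvdE.
have [f f_bij] := critical_group_order (size_word_leaves w)
  (double_lcm_leaves_gt0 w) (@leaves_dvd_double_lcm _ w) (double_lcm_reciprocals w).
have [f' [g' f'K g'K]] := critical_group_order (size_word_leaves w')
  (double_lcm_leaves_gt0 w') (@leaves_dvd_double_lcm _ w') (double_lcm_reciprocals w').
case: iso => h h_bij; rewrite /prod_seq -[LHS]card_ord -[RHS]card_ord.
have g'_bij : bijective g' by exists f'.
exact: bij_eq_card (bij_comp g'_bij (bij_comp h_bij f_bij)).
Qed.

Theorem proposition27 (n : nat) (hn : (2 <= n)%N) :
  card_geq (critical_group_classes (star n)) (2 ^ (n - 2)).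
Proof.
(* Of the n = m + 2 leaves, m come from a word and two equal [N]. *)
case: n hn => [|[|m]] // _; rewrite subn2 /=.
have cardE : #|{: m.-tuple bool}| = 2 ^ m by rewrite card_tuple card_bool.
pose word i := enum_val (cast_ord (esym cardE) i).
exists (fun i => iso_class (critical_group (word_structure (word i)))).
  move=> i j /iso_class_isomorphic/word_structure_determined/enum_val_inj.
  exact: cast_ord_inj.
by move=> i; exists (word_structure (word i)).
Qed.
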